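(* Let $m,n\ge 2$ be integers and let $\mathcal{A}=(a_{j_1\cdots j_m})$ be a real $m$th order $n$-dimensional circulant tensor with root tensor $\mathcal{A}_1=(\alpha_{j_1\cdots j_{m-1}})$, associated tensor $\bar{\mathcal{A}}_1=(\bar\alpha_{j_1\cdots j_{m-1}})$, and diagonal entry $c_0=a_{1\cdots 1}=\alpha_{1\cdots 1}$. Then any eigenvalue $\lambda$ of $\mathcal{A}$ satisfies $$|\lambda-c_0|\le \sum_{j_1,\dots,j_{m-1}=1}^n |\bar\alpha_{j_1\cdots j_{m-1}}|.$$ Furthermore, for each $k\in\{0,1,\dots,n-1\}$, with $\omega_k=e^{2\pi i k/n}$, the vector $\mathbf{v}_k=(1,\omega_k,\omega_k^2,\dots,\omega_k^{n-1})^\top$ is an eigenvector of $\mathcal{A}$ with corresponding eigenvalue $\lambda_k(\mathcal{A})=f_{\mathcal{A}}(\omega_k)$, where $$f_{\mathcal{A}}(t)=\sum_{j_1,\dots,j_{m-1}=1}^n \alpha_{j_1\cdots j_{m-1}}\,t^{\,j_1+\cdots+j_{m-1}-m+1}.$$ In particular, $\mathcal{A}$ always has the H-eigenvalue $$\lambda_0(\mathcal{A})=\sum_{j_1,\dots,j_{m-1}=1}^n\alpha_{j_1\cdots j_{m-1}}$$ with H-eigenvector $\mathbf{1}=(1,\dots,1)^\top$, and when $n$ is even, $$\lambda_{n/2}(\mathcal{A})=\sum_{j_1,\dots,j_{m-1}=1}^n\alpha_{j_1\cdots j_{m-1}}(-1)^{j_1+\cdots+j_{m-1}-m+1}$$ is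 also an H-eigenvalue of $\mathcal{A}$, with H-eigenvector $\hat{\mathbf{1}}=(1,-1,1,-1,\dots)^\top\in\mathbb{R}^n$.
   Context: Write $[n]=\{1,\dots,n\}$. A real $m$th order $n$-dimensional tensor is an array $\mathcal{A}=(a_{j_1\cdots j_m})$ of real numbers indexed by $(j_1,\dots,j_m)\in[n]^m$. It is circulant if $a_{j_1\cdots j_m}=a_{k_1\cdots k_m}$ whenever $j_l,k_l\in[n]$ and $k_l\equiv j_l+1 \pmod n$ for all $l\in[m]$; in particular all diagonal entries $a_{j\cdots j}$ are equal, and their common value is called the diagonal entry. The root tensor of a circulant tensor $\mathcal{A}$ is the order $m-1$, dimension $n$ tensor $\mathcal{A}_1=(\alpha_{j_1\cdots j_{m-1}})$ with $\alpha_{j_1\cdots j_{m-1}}=a_{1j_1\cdots j_{m-1}}$. The associated tensor $\bar{\mathcal{A}}_1=(\bar\alpha_{j_1\cdots j_{m-1}})$ is obtained from $\mathcal{A}_1$ by setting $\bar\alpha_{1\cdots1}=0$ and keeping all other entries. For $\mathbf{x}\in\mathbb{C}^n$, $\mathcal{A}\mathbf{x}^{m-1}\in\mathbb{C}^n$ has $j$th component $\sum_{j_2,\dots,j_m=1}^n a_{jj_2\cdots j_m}x_{j_2}\cdots x_{j_m}$, and $\mathbf{x}^{[m-1]}$ has $j$th component $x_j^{m-1}$. A number $\lambda\in\mathbb{C}$ is an eigenvalue of $\mathcal{A}$ with eigenvector $\mathbf{x}\in\mathbb{C}^n\setminus\{\mathbf{0}\}$ if $\mathcal{A}\mathbf{x}^{m-1}=\lambda\mathbf{x}^{[m-1]}$.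 If $\mathbf{x}$ is real (then $\lambda$ is real), they are called an H-eigenvalue and an H-eigenvector. *)

(* Defs.v *)
From mathcomp Require Import all_boot all_order all_algebra.
From mathcomp Require Import all_classical all_reals all_analysis.
From mathcomp Require Import complex.

Set Implicit Arguments.
Unset Strict Implicit.
Unset Printing Implicit Defensive.

Import Order.TTheory GRing.Theory Num.Theory.
Local Open Scope ring_scope.
Local Open Scope complex_scope.

(* The index set [n] = {1, ..., n} is rendered by 'I_n = {0, ..., n-1}: the
   1-based index j is the ordinal of value j-1.  In particular the entry
   (1, ..., 1) sits at the constant tuple of value 0, and an exponent
   j_1 + ... + j_p - p is the sum of the ordinal values. *)
Definition tensor (T : Type) (m n : nat) := {ffun m.-tuple 'I_n -> T}.

Definition circulant (R : Type) (m n : nat) (A : tensor R m n) : Prop :=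
  forall j k : m.-tuple 'I_n,
    (forall l : 'I_m, tnth k l = (tnth j l).+1 %[mod n]) -> A j = A k.

Definition root_tensor (R : Type) (m n : nat) (A : tensor R m.+1 n.+1) :
    tensor R m n.+1 :=
  [ffun j : m.-tuple 'I_n.+1 => A [tuple of ord0 :: j]].

Definition associated_tensor (R : pzRingType) (m n : nat)
    (A : tensor R m.+1 n.+1) : tensor R m n.+1 :=
  [ffun j : m.-tuple 'I_n.+1 =>
     if j == nseq_tuple m ord0 then 0 else root_tensor A j].

Definition diag_entry (R : Type) (m n : nat) (A : tensor R m n.+1) : R :=
  A (nseq_tuple m ord0).

(* For A of order m+1, the vector usually written A x^m. *)
Definition tensor_app (R : realType) (m n : nat) (A : tensor R m.+1 n)
    (x : 'cV[R[i]]_n) : 'cV[R[i]]_n :=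
  \col_j \sum_(s : m.-tuple 'I_n)
     (A [tuple of j :: s])%:C * \prod_(l < m) x (tnth s l) 0.

(* The vector written x^{[p]}. *)
Definition vpow (K : pzRingType) (n : nat) (x : 'cV[K]_n) (p : nat) : 'cV[K]_n :=
  \col_j x j 0 ^+ p.

Definition eigenpair (R : realType) (m n : nat) (A : tensor R m.+1 n)
    (lambda : R[i]) (x : 'cV[R[i]]_n) : Prop :=
  x != 0 /\ tensor_app A x = lambda *: vpow x m.

Definition tensor_eigenvalue (R : realType) (m n : nat) (A : tensor R m.+1 n)
    (lambda : R[i]) : Prop :=
  exists x : 'cV[R[i]]_n, eigenpair A lambda x.

(* A real vector x that is an eigenvector forces the eigenvalue to be real,
   hence mu : R. *)
Definition H_eigenpair (R : realType) (m n : nat) (A : tensor R m.+1 n)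
    (mu : R) (x : 'cV[R]_n) : Prop :=
  eigenpair A mu%:C (map_mx (real_complex R) x).

(* e^(a + ib) = e^a (cos b + i sin b); the library has no complex exponential. *)
Definition cexp (R : realType) (z : R[i]) : R[i] :=
  let: a +i* b := z in (expR a)%:C * (cos b +i* sin b).

Definition omega (R : realType) (n k : nat) : R[i] :=
  cexp (0 +i* (2 * pi * k%:R / n%:R)).

Definition circ_vec (R : realType) (n k : nat) : 'cV[R[i]]_n :=
  \col_(j < n) omega R n k ^+ j.

Definition assoc_fun (R : realType) (m n : nat) (A : tensor R m.+1 n.+1)
    (t : R[i]) : R[i] :=
  \sum_(j : m.-tuple 'I_n.+1)
    (root_tensor A j)%:C * t ^+ (\sum_(l < m) tnth j l)%N.

Definition circ_eigval (R : realType) (m n : nat) (A : tensor R m.+1 n.+1)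
    (k : nat) : R[i] :=
  assoc_fun A (omega R n.+1 k).

(* Main.v *)
(* Circulance identifies row j of A with row 0 shifted by j, so that
   (A x^m)_j is the sum over s of the root entry alpha_s times the product of the
   x_(s_l + j), with indices mod n.  Evaluating at a coordinate of largest modulus
   gives the Gershgorin-type bound; for x_j = t^j with t^n = 1 the product is
   t^(s_1 + ... + s_m) (t^j)^m, which gives the eigenvectors. *)

Require Import Defs.
From mathcomp Require Import all_boot all_order all_algebra.
From mathcomp Require Import all_classical all_reals all_analysis.
From mathcomp Require Import complex.

Set Implicit Arguments.
Unset Strict Implicit.
Unset Printing Implicit Defensive.

Import Order.TTheory GRing.Theory Num.Theory.
Local Open Scope ring_scope.
Local Open Scope complex_scope.

Section Circulant.
Context {T : Type} {m n : nat}.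

(** Addition in ['I_n.+1] is modulo $n+1$, so this is a simultaneous cyclic shift of all indices. *)
Definition shift_tuple (c : 'I_n.+1) (s : m.-tuple 'I_n.+1) :
    m.-tuple 'I_n.+1 :=
  map_tuple (fun i => i + c) s.

Lemma shift_tuple_bij (c : 'I_n.+1) : bijective (shift_tuple c).
Proof.
exists (fun s => map_tuple (fun i => i - c) s) => s;
  by apply: eq_from_tnth => l; rewrite !tnth_map ?addrK ?subrK.
Qed.

End Circulant.

Lemma circulant_shift (T : Type) (m n : nat) (A : tensor T m n.+1)
    (hA : circulant A) (c : 'I_n.+1) (s : m.-tuple 'I_n.+1) :
  A (shift_tuple c s) = A s.
Proof.
(* Circulance is the shift by one. It is iterated by induction on a natural number $k$, read modulo
   $n+1$, which reaches every [c]. *)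
suff H k : A (shift_tuple (inZp k) s) = A s by rewrite -(H c) valZpK.
elim: k => [|k <-]; last first.
  symmetry; apply: hA => l; rewrite !tnth_map /= modnDmr modn_mod.
  have modS a b : b.+1 = (b %% a).+1 %[mod a] by rewrite -addn1 -modnDml addn1.
  by rewrite -modS -addSn modnDmr addSnnS.
congr (A _); apply: eq_from_tnth => l; rewrite tnth_map.
by apply: val_inj; rewrite /= mod0n addn0 modn_small.
Qed.

Lemma circulant_row (T : Type) (m n : nat) (A : tensor T m.+1 n.+1)
    (hA : circulant A) (j : 'I_n.+1) (s : m.-tuple 'I_n.+1) :
  A [tuple of j :: shift_tuple j s] = root_tensor A s.
Proof.
rewrite ffunE -[RHS](circulant_shift hA j); congr (A _); apply: val_inj => /=.
by rewrite add0r.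
Qed.

Lemma tensor_app_circulant (R : realType) (m n : nat) (A : tensor R m.+1 n.+1)
    (hA : circulant A) (x : 'cV[R[i]]_n.+1) (j : 'I_n.+1) :
  tensor_app A x j 0 =
  \sum_(s : m.-tuple 'I_n.+1)
    (root_tensor A s)%:C * \prod_(l < m) x (tnth s l + j) 0.
Proof.
rewrite mxE (reindex (shift_tuple j)); last exact/onW_bij/shift_tuple_bij.
apply: eq_bigr => s _; rewrite circulant_row //; congr (_ * _).
by apply: eq_bigr => l _; rewrite tnth_map.
Qed.

Lemma circulant_eigenpair (R : realType) (m n : nat) (A : tensor R m.+1 n.+1)
    (hA : circulant A) (t : R[i]) (ht : t ^+ n.+1 = 1) :
  eigenpair A (assoc_fun A t) (\col_(j < n.+1) t ^+ j).
Proof.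
split.
  by apply/eqP => /matrixP/(_ 0 0)/eqP; rewrite !mxE expr0 oner_eq0.
apply/matrixP => j z; rewrite ord1 tensor_app_circulant // !mxE mulr_suml.
apply: eq_bigr => s _; rewrite -mulrA; congr (_ * _).
under eq_bigr => l _ do rewrite mxE /= expr_mod // exprD.
by rewrite big_split /= prodr_const card_ord -expr_sum.
Qed.

Lemma circulant_eigenvalue_bound (R : realType) (m n : nat)
    (A : tensor R m.+1 n.+1) (hA : circulant A) (lambda : R[i]) :
  tensor_eigenvalue A lambda ->
  `|lambda - (diag_entry A)%:C|
    <= (\sum_(j : m.-tuple 'I_n.+1) `|associated_tensor A j|)%:C.
Proof.
move=> [x [x0 /matrixP eAx]].
have [j hj] : exists j, forall i, `|x i 0| <= `|x j 0|.
  (* R[i] is only partially ordered, so maximize the R-valued modulus. *)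
  have [j _ hj] := @arg_maxP _ _ _ ord0 predT (fun i => Normc.normc (x i 0)) isT.
  by exists j => i; rewrite lecR; exact: hj.
(* A maximal modulus equal to zero would force [x = 0]. *)
have xj0 : 0 < `|x j 0|.
  rewrite lt_def normr_ge0 andbT; apply: contra x0 => /eqP xj0.
  apply/eqP/matrixP => i z; rewrite ord1 mxE; apply/eqP.
  by rewrite -normr_le0 -xj0.
have e0 : A [tuple of ord0 :: nseq_tuple m ord0] = diag_entry A.
  by congr (A _); apply: val_inj.
(* The zero tuple contributes the diagonal entry times $x_j^m$, because $0+j=j$. Moving this term to
   the left turns the root tensor into the associated one. *)
have eD : (lambda - (diag_entry A)%:C) * x j 0 ^+ m =
    \sum_(s : m.-tuple 'I_n.+1)
      (associated_tensor A s)%:C * \prod_(l < m) x (tnth s l + j) 0.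
  have := eAx j 0; rewrite tensor_app_circulant // !mxE mulrBl => <-.
  rewrite (bigD1 (nseq_tuple m ord0)) //= [RHS](bigD1 (nseq_tuple m ord0)) //=.
  rewrite !ffunE eqxx mul0r add0r e0.
  under [\prod_(_ < m) _]eq_bigr => l _.
    rewrite (_ : tnth _ l + j = j); first over.
    by rewrite (tnth_nth ord0) nth_nseq ltn_ord add0r.
  rewrite prodr_const card_ord addrAC subrr add0r.
  by apply: eq_bigr => s /negPf s0; rewrite [associated_tensor A s]ffunE s0.
(* After multiplication by $|x_j|^m>0$, the triangle inequality applies, and each of the $m$ factors
   of a product is at most $|x_j|$ in modulus. *)
rewrite -(ler_pM2r (exprn_gt0 m xj0)) -normrX -normrM eD.
rewrite rmorph_sum mulr_suml; apply: (le_trans (ler_norm_sum _ _ _)).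
apply: ler_sum => s _; rewrite normrM normc_def /= expr0n addr0 sqrtr_sqr.
apply: ler_wpM2l; first by rewrite lecR.
rewrite normr_prod normrX.
rewrite -[X in _ ^+ X]card_ord -prodr_const.
by apply: ler_prod => l _; rewrite normr_ge0 hj.
Qed.

(** De Moivre's formula, from the addition formulas for [cos] and [sin]. *)
Lemma cexpX (R : realType) (b : R) (k : nat) :
  cexp (0 +i* b) ^+ k = cexp (0 +i* (b *+ k)).
Proof.
elim: k => [|k IH]; first by rewrite mulr0n /= expR0 cos0 sin0 !mul1r expr0.
rewrite exprS IH /= expR0 !mul1r mulrS cosD sinD.
by simpc; congr (_ +i* _); rewrite addrC.
Qed.

Lemma omega_expn (R : realType) (n k : nat) : omega R n.+1 k ^+ n.+1 = 1.
Proof.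
(* The total angle is $2\pi k$, so the power equals $((e^{i\pi})^2)^k=((-1)^2)^k$. *)
rewrite cexpX -[_ *+ n.+1]mulr_natr divfK ?pnatr_eq0 // mulr_natr -cexpX.
rewrite mulr_natl -cexpX [cexp _](_ : _ = -1) ?sqrrN ?expr1n //.
by rewrite /= expR0 mul1r cospi sinpi; simpc.
Qed.

Lemma omega0 (R : realType) (n : nat) : omega R n 0 = 1.
Proof. by rewrite /omega mulr0 mul0r /= expR0 cos0 sin0 mul1r. Qed.

Lemma omega_half (R : realType) (n : nat) :
  (0 < n)%N -> ~~ odd n -> omega R n n./2 = -1.
Proof.
move=> n_gt0 n_even; rewrite /omega [X in _ +i* X](_ : _ = pi).
  by rewrite /= expR0 mul1r cospi sinpi; simpc.
(* Evenness makes twice [n./2] equal to [n], so the angle is exactly $\pi$. *)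
rewrite [2 * pi]mulrC -[pi * 2 * _]mulrA -natrM mul2n even_halfK // mulfK //.
by rewrite pnatr_eq0 -lt0n.
Qed.

Theorem theorem1 (R : realType) (m n : nat)
    (hm : (2 <= m.+1)%N) (hn : (2 <= n.+1)%N)
    (A : tensor R m.+1 n.+1) (hA : circulant A) :
  [/\ (forall lambda : R[i], tensor_eigenvalue A lambda ->
         `|lambda - (diag_entry A)%:C|
           <= (\sum_(j : m.-tuple 'I_n.+1) `|associated_tensor A j|)%:C),
      (forall k : nat, (k < n.+1)%N ->
         eigenpair A (circ_eigval A k) (circ_vec R n.+1 k)),
      (let mu := \sum_(j : m.-tuple 'I_n.+1) root_tensor A j in
       circ_eigval A 0 = mu%:C /\ H_eigenpair A mu (const_mx 1)) &
      (~~ odd n.+1 ->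
       let mu := \sum_(j : m.-tuple 'I_n.+1)
                   root_tensor A j * (-1) ^+ (\sum_(l < m) tnth j l)%N in
       circ_eigval A (n.+1)./2 = mu%:C /\
       H_eigenpair A mu (\col_(j < n.+1) (-1) ^+ j))].
Proof.
split.
- by move=> lambda; apply: circulant_eigenvalue_bound.
- by move=> k _; apply: circulant_eigenpair => //; apply: omega_expn.
- set mu := \sum_j _ => /=.
  have e : circ_eigval A 0 = mu%:C.
    rewrite /circ_eigval omega0 rmorph_sum.
    by apply: eq_bigr => j _; rewrite expr1n mulr1.
  split=> //; rewrite /H_eigenpair -e.
  (* The all-ones vector is $\mathbf{v}_0$, as $\omega_0=1$. *)
  have -> : map_mx (real_complex R) (const_mx 1) = \col_(j < n.+1) omega R n.+1 0 ^+ j.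
    by apply/matrixP => i j; rewrite !mxE omega0 expr1n.
  by apply: circulant_eigenpair => //; apply: omega_expn.
- move=> n_even; set mu := \sum_j _ => /=.
  have w := omega_half R (ltn0Sn n) n_even.
  have e : circ_eigval A (n.+1)./2 = mu%:C.
    rewrite /circ_eigval w rmorph_sum.
    by apply: eq_bigr => j _; rewrite rmorphM rmorphXn rmorphN rmorph1.
  split=> //; rewrite /H_eigenpair -e.
  (* The alternating vector is the circulant eigenvector of the middle index, whose root of unity is
     $-1$. *)
  have -> : map_mx (real_complex R) (\col_(j < n.+1) (-1) ^+ j) =
      \col_(j < n.+1) omega R n.+1 (n.+1)./2 ^+ j.
    by apply/matrixP => j z; rewrite !mxE w rmorphXn rmorphN rmorph1.
  by apply: circulant_eigenpair => //; apply: omega_expn.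
Qed.
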